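(* The linear map $\Phi:\mathit{NCK}\to\mathit{LR}$ defined on ordered forests by $\Phi(f)=M^*_{\varphi(f)}$ is an isomorphism of graded Hopf algebras.
   Context: Trees: $\mathcal{Y}_n$ = rooted planar binary trees with $n$ internal nodes, $\mathcal{Y}_0=\{|\}$; $s\vee t$ = root with left subtree $s$, right subtree $t$; $|\backslash t=t$, $s\backslash t=s_l\vee(s_r\backslash t)$. Tamari order: generated by replacing a subtree $(a\vee b)\vee c$ by the larger $a\vee(b\vee c)$. $\mathcal{Y}Sym$: graded connected Hopf algebra over $\mathbb{Q}$ with basis $F_t$; leaves of $t\in\mathcal{Y}_p$ numbered $0..p$; splitting at leaf $i$: $|\to(|,|)$, $t_l\vee t_r\to(a,b\vee t_r)$ if leaf $i$ in $t_l$ and $t_l\to(a,b)$, $\to(t_l\vee c,d)$ if in $t_r$ and $t_r\to(c,d)$; $\Delta(F_t)=\sum_iF_{t_0}\otimes F_{t_1}$; for $s\in\mathcal{Y}_q$, $F_t\cdot F_s=\sum F_{(t_0,..,t_q)/s}$ over multisets $i_1\le..\le i_q$ of leaves of $t$, the division splitting $t$ at $i_q$ into $(t',t_q)$ and dividing $t'$ at $i_1..i_{q-1}$, and $(t_0,..,t_q)/s$ grafting the root of $t_i$ on leaf $i$ of $s$. $M_t=\sum_{t\le s}\mu_{\mathcal{Y}_n}(t,s)F_s$. $\mathit{LR}$ is the graded dual Hopf algebra of $\mathcal{Y}Sym$, $\{M^*_t\}$ the basis dual to $\{M_t\}$. $\mathit{NCK}$ (non-commutative Connes–Kreimer Hopf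 algebra): the free associative algebra over $\mathbb{Q}$ on the set of finite rooted planar trees; its basis is ordered forests (finite sequences of rooted planar trees), the empty forest is the unit, product is concatenation, degree is the total number of nodes. A set $\mathsf{R}$ of nodes of a forest $f$ is admissible if every descendant of a node in $\mathsf{R}$ is in $\mathsf{R}$; $f'_{\mathsf{R}}$ is the ordered forest of subtrees formed by $\mathsf{R}$ (the subtrees rooted at nodes of $\mathsf{R}$ whose parent is not in $\mathsf{R}$), in left-to-right planar order, and $f''_{\mathsf{R}}$ is the ordered forest remaining after deleting $\mathsf{R}$. Coproduct: $\Delta(f)=\sum_{\mathsf{R}}f'_{\mathsf{R}}\otimes f''_{\mathsf{R}}$ over admissible $\mathsf{R}$. $\varphi$: from ordered forests to planar binary trees: $\varphi(\emptyset)=|$; for a rooted planar tree $T$ whose root has children subtrees forming the forest $f$ (in order), $\varphi(T)=\varphi(f)\vee|$; for $f=(T_1,\dots,T_k)$, $\varphi(f)=\varphi(T_1)\backslash\cdots\backslash\varphi(T_k)$. *)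

(* Defs.v *)
From HB Require Import structures.
From mathcomp Require Import all_boot all_algebra.
From mathcomp Require Import finmap monalg.
From Stdlib Require Import Relations ClassicalEpsilon.

Set Implicit Arguments.
Unset Strict Implicit.
Unset Printing Implicit Defensive.

Import GRing.Theory.
Local Open Scope ring_scope.

Definition Free (X : choiceType) := {malg rat[X]}.

Definition lext (X : choiceType) (V : lmodType rat) (g : X -> V)
  (x : Free X) : V := \sum_(k <- msupp x) x@_k *: g k.

Definition bilext (X Y Z : choiceType) (m : X -> Y -> Free Z)
  (x : Free X) (y : Free Y) : Free Z :=
  \sum_(a <- msupp x) \sum_(b <- msupp y) (x@_a * y@_b) *: m a b.

(* x (x) y in Free X (x) Free Y = Free (X * Y) *)
Definition tensv (X Y : choiceType) (x : Free X) (y : Free Y) : Free (X * Y)%type :=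
  bilext (fun a b => << (a, b) >>) x y.

Definition tensmap (X Y : choiceType) (F : Free X -> Free Y) :
  Free (X * X)%type -> Free (Y * Y)%type :=
  lext (fun p => tensv (F << p.1 >>) (F << p.2 >>)).

Definition homog (X : choiceType) (deg : X -> nat) (n : nat) (x : Free X) :=
  all (fun k => deg k == n) (msupp x).

Inductive bt := Lf | Nd of bt & bt.

Fixpoint bt_enc (t : bt) : GenTree.tree unit :=
  match t with
  | Lf => GenTree.Leaf tt
  | Nd l r => GenTree.Node 0 [:: bt_enc l; bt_enc r]
  end.
Fixpoint bt_dec (t : GenTree.tree unit) : bt :=
  match t with
  | GenTree.Node _ [:: l; r] => Nd (bt_dec l) (bt_dec r)
  | _ => Lf
  end.
Lemma bt_encK : cancel bt_enc bt_dec.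
Proof. by elim=> //= l -> r ->. Qed.
HB.instance Definition _ := Countable.copy bt (can_type bt_encK).

Fixpoint sbt (t : bt) : nat :=
  match t with Lf => 0%N | Nd l r => (sbt l + sbt r).+1 end.

Fixpoint over (s t : bt) : bt :=
  match s with Lf => t | Nd l r => Nd l (over r t) end.

Fixpoint allbt (h : nat) : seq bt :=
  match h with
  | 0 => [:: Lf]
  | h'.+1 => Lf :: [seq Nd l r | l <- allbt h', r <- allbt h']
  end.
Definition trees (n : nat) : seq bt := [seq t <- undup (allbt n) | sbt t == n].

Inductive rot : bt -> bt -> Prop :=
| rot_root a b c : rot (Nd (Nd a b) c) (Nd a (Nd b c))
| rot_l l l' r : rot l l' -> rot (Nd l r) (Nd l' r)
| rot_r l r r' : rot r r' -> rot (Nd l r) (Nd l r').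

Definition tamari_le (s t : bt) : Prop := clos_refl_trans bt rot s t.
Definition tle (s t : bt) : bool :=
  if excluded_middle_informative (tamari_le s t) then true else false.

(* Moebius function of Y_n, by the defining recursion
   mu(t,t) = 1, mu(t,s) = - sum_{t <= u < s} mu(t,u) for t < s, 0 otherwise;
   the fuel k bounds the length of chains (any k >= #Y_n is enough). *)
Fixpoint mob_fuel (k n : nat) (t s : bt) : rat :=
  match k with
  | 0 => (t == s)%:R
  | k'.+1 =>
    if t == s then 1 else
    if tle t s then
      - \sum_(u <- trees n | tle t u && tle u s && (u != s)) mob_fuel k' n t u
    else 0
  end.
Definition mobius (n : nat) (t s : bt) : rat := mob_fuel (size (trees n)) n t s.

(* splitting at leaf i (leaves of t numbered 0 .. sbt t) *)
Fixpoint bsplit (t : bt) (i : nat) : bt * bt :=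
  match t with
  | Lf => (Lf, Lf)
  | Nd l r =>
    if (i <= sbt l)%N then let: (a, b) := bsplit l i in (a, Nd b r)
    else let: (c, d) := bsplit r (i - (sbt l).+1) in (Nd l c, d)
  end.

(* division at the multiset given as a weakly DECREASING list
   [:: i_q; i_(q-1); ...; i_1] *)
Fixpoint divide (t : bt) (js : seq nat) : seq bt :=
  match js with
  | [::] => [:: t]
  | i :: js' => let: (t', tq) := bsplit t i in rcons (divide t' js') tq
  end.

(* weakly decreasing lists of length q with entries <= m
   (= multisets i_1 <= ... <= i_q of {0..m}) *)
Fixpoint msets (q m : nat) : seq (seq nat) :=
  match q with
  | 0 => [:: [::]]
  | q'.+1 => flatten [seq [seq i :: s | s <- msets q' i] | i <- iota 0 m.+1]
  end.

Fixpoint graft (s : bt) (ts : seq bt) : bt :=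
  match s with
  | Lf => head Lf ts
  | Nd l r => Nd (graft l (take (sbt l).+1 ts)) (graft r (drop (sbt l).+1 ts))
  end.

Definition ysym_cop (t : bt) : Free (bt * bt)%type :=
  \sum_(i < (sbt t).+1) << bsplit t i >>.

Definition ysym_mul (t s : bt) : Free bt :=
  \sum_(js <- msets (sbt s) (sbt t)) << graft s (divide t js) >>.

(* the M-basis: M_t = sum_{t <= s} mu(t,s) F_s; change-of-basis matrix of Y_n *)
Definition Mmat (n : nat) : 'M[rat]_(size (trees n)) :=
  \matrix_(i, j) (if tle (nth Lf (trees n) i) (nth Lf (trees n) j)
                  then mobius n (nth Lf (trees n) i) (nth Lf (trees n) j) else 0).

(* LR = graded dual of YSym.  An element of LR is represented by its   *)
(* coordinates on the basis {F*_t} dual to {F_t} (so <xi, F_t> = xi@_t)*)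

(* (F*_a . F*_b)(F_t) = (F*_a (x) F*_b)(Delta F_t) for t in Y_{|a|+|b|} *)
Definition lr_mul_basis (a b : bt) : Free bt :=
  \sum_(t <- trees (sbt a + sbt b)) (ysym_cop t)@_(a, b) *: << t >>.
Definition lr_mul : Free bt -> Free bt -> Free bt := bilext lr_mul_basis.

(* Delta(F*_t)(F_a (x) F_b) = F*_t(F_a . F_b), |a| + |b| = |t| *)
Definition lr_cop_basis (t : bt) : Free (bt * bt)%type :=
  \sum_(p < (sbt t).+1) \sum_(a <- trees p) \sum_(b <- trees (sbt t - p))
     (ysym_mul a b)@_t *: << (a, b) >>.
Definition lr_cop : Free bt -> Free (bt * bt)%type := lext lr_cop_basis.

(* unit of LR = counit of YSym (F_t |-> [t = |]); counit of LR = evaluation at 1 = F_| *)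
Definition lr_one : Free bt := << Lf >>.
Definition lr_counit (x : Free bt) : rat := x@_Lf.

(* M*_t : the element of LR with <M*_t, M_s> = [t = s];
   with A = Mmat n (M_u = sum_s A_{u,s} F_s) one has M*_t = sum_s (A^-1)_{s,t} F*_s *)
Definition Mstar (t : bt) : Free bt :=
  let ts := trees (sbt t) in
  \sum_(i < size ts) \sum_(j < size ts | nth Lf ts j == t)
     invmx (Mmat (sbt t)) i j *: << nth Lf ts i >>.

Inductive ptree := PNode of seq ptree.
Definition forest := seq ptree.

Fixpoint pt_enc (t : ptree) : GenTree.tree unit :=
  let: PNode ts := t in GenTree.Node 0 (map pt_enc ts).
Fixpoint pt_dec (t : GenTree.tree unit) : ptree :=
  match t with
  | GenTree.Leaf _ => PNode [::]
  | GenTree.Node _ ts => PNode (map pt_dec ts)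
  end.
Fixpoint pt_encK (t : ptree) : pt_dec (pt_enc t) = t :=
  match t return pt_dec (pt_enc t) = t with
  | PNode ts => f_equal PNode
      ((fix aux (ts : seq ptree) : map pt_dec (map pt_enc ts) = ts :=
          match ts return map pt_dec (map pt_enc ts) = ts with
          | [::] => erefl
          | t :: ts' => f_equal2 cons (pt_encK t) (aux ts')
          end) ts)
  end.
HB.instance Definition _ := Countable.copy ptree (can_type pt_encK).

(* nodes of a tree, as addresses (paths of child indices from the root) *)
Fixpoint tnodes (T : ptree) : seq (seq nat) :=
  let: PNode ts := T in
  [::] :: (fix aux (i : nat) (ts : seq ptree) : seq (seq nat) :=
             match ts with
             | [::] => [::]
             | T' :: ts' => map (cons i) (tnodes T') ++ aux i.+1 ts'
             end) 0%N ts.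

Fixpoint fnodes_from (i : nat) (f : forest) : seq (seq nat) :=
  match f with
  | [::] => [::]
  | T :: f' => map (cons i) (tnodes T) ++ fnodes_from i.+1 f'
  end.
(* nodes of a forest: first index = position of the tree in the forest *)
Definition fnodes (f : forest) : seq (seq nat) := fnodes_from 0 f.

Definition nck_deg (f : forest) : nat := size (fnodes f).

(* For a set R of nodes (predicate on addresses), the pair (f'_R, f''_R):
   at a node of R the whole subtree goes to f'; otherwise the node stays and
   its children are processed left to right. *)
Fixpoint tcut (R : pred (seq nat)) (a : seq nat) (T : ptree) : forest * forest :=
  let: PNode ts := T in
  if R a then ([:: T], [::]) else
  let cs := (fix aux (i : nat) (ts : seq ptree) : seq (forest * forest) :=
               match ts with
               | [::] => [::]
               | T' :: ts' => tcut R (rcons a i) T' :: aux i.+1 ts'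
               end) 0%N ts in
  (flatten (map fst cs), [:: PNode (flatten (map snd cs))]).

Fixpoint fcut_from (R : pred (seq nat)) (i : nat) (f : forest) : seq (forest * forest) :=
  match f with
  | [::] => [::]
  | T :: f' => tcut R [:: i] T :: fcut_from R i.+1 f'
  end.
Definition fcut (R : pred (seq nat)) (f : forest) : forest * forest :=
  let cs := fcut_from R 0 f in (flatten (map fst cs), flatten (map snd cs)).

Definition nodeset (f : forest) (S : {set 'I_(size (fnodes f))}) : pred (seq nat) :=
  fun a => [exists i in S, nth [::] (fnodes f) i == a].

(* admissible: every descendant (extension of the address) of a node of R is in R *)
Definition admissible (f : forest) (R : pred (seq nat)) : bool :=
  all (fun a => all (fun b => (R a && prefix a b) ==> R b) (fnodes f)) (fnodes f).

Definition nck_mul : Free (seq ptree) -> Free (seq ptree) -> Free (seq ptree) := bilext (fun f g => << f ++ g >>).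
Definition nck_one : Free (seq ptree) := << [::] >>.
Definition nck_counit (x : Free (seq ptree)) : rat := x@_[::].
Definition nck_cop_basis (f : forest) : Free (seq ptree * seq ptree)%type :=
  \sum_(S : {set 'I_(size (fnodes f))} | admissible f (nodeset S))
     << fcut (nodeset S) f >>.
Definition nck_cop : Free (seq ptree) -> Free (seq ptree * seq ptree)%type :=
  lext nck_cop_basis.

Fixpoint phi_tree (T : ptree) : bt :=
  let: PNode ts := T in
  Nd ((fix aux (ts : seq ptree) : bt :=
         match ts with [::] => Lf | T' :: ts' => over (phi_tree T') (aux ts') end) ts)
     Lf.
(* phi(T_1,...,T_k) = phi(T_1) \ ... \ phi(T_k)  (\ is associative) *)
Fixpoint phi (f : forest) : bt :=
  match f with [::] => Lf | T :: f' => over (phi_tree T) (phi f') end.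

Definition Phi : Free (seq ptree) -> Free bt := lext (fun f => Mstar (phi f)).

(* Main.v *)
(** Since [M_t] is the Moebius transform of [F_t], the dual basis is
    [M*_t = sum_(s <= t) F*_s], so products and coproducts of the [M*_t] are counts
    of trees below a given tree.

    Product: splitting at leaf [|a|] is left adjoint to [(a, b) |-> a \ b] for the
    Tamari order, hence [M*_a M*_b = M*_(a \ b)].

    Coproduct: the coefficient of [F*_a (x) F*_b] in [Delta (M*_t)] is the number of
    terms [x] of [F_a F_b] with [x <= t].  For [t = u \ v] the adjunction
    and the compatibility of product and splitting in YSym factor this count over the
    ways of splitting [a] and [b]; for [t = s \/ |] only [x = y \/ |] with [y <= s]
    contributes.  The number of admissible cuts [R] of [f] with
    [a <= phi (f'_R)] and [b <= phi (f''_R)] obeys the same recursion for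
    [t = phi f]. *)

Require Import Defs.
From HB Require Import structures.
From mathcomp Require Import all_boot all_algebra.
From mathcomp Require Import finmap monalg zify.
From Stdlib Require Import Relations ClassicalEpsilon.

Set Implicit Arguments.
Unset Strict Implicit.
Unset Printing Implicit Defensive.

Import GRing.Theory.

(* [over] and [rot] would otherwise be those of MathComp. *)
Import Defs.

(** * Binary trees and splittings *)

Lemma sbt_eq0 t : (sbt t == 0) = (t == Lf).
Proof. by case: t. Qed.

Lemma sbt_over s t : sbt (over s t) = sbt s + sbt t.
Proof. by elim: s => //= l _ r ->; lia. Qed.

Lemma overA s t u : over s (over t u) = over (over s t) u.
Proof. by elim: s => //= l _ r ->. Qed.

Lemma mem_allbt h t : sbt t <= h -> t \in allbt h.
Proof.
elim: h t => [|h IH] [|l r] //= hlt.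
rewrite inE /=; apply/allpairsP; exists (l, r) => /=.
by split=> //; apply: IH; lia.
Qed.

Lemma mem_trees n t : (t \in trees n) = (sbt t == n).
Proof.
rewrite mem_filter mem_undup; case: eqP => //= <-.
exact: mem_allbt.
Qed.

Lemma trees_uniq n : uniq (trees n).
Proof. exact/filter_uniq/undup_uniq. Qed.

Lemma bsplit_Nd l r i : bsplit (Nd l r) i =
  if i <= sbt l then ((bsplit l i).1, Nd (bsplit l i).2 r)
  else (Nd l (bsplit r (i - (sbt l).+1)).1, (bsplit r (i - (sbt l).+1)).2).
Proof. by rewrite /=; do 2![case: bsplit => ? ?]. Qed.

Lemma sbt_bsplit t i : sbt (bsplit t i).1 + sbt (bsplit t i).2 = sbt t.
Proof.
elim: t i => [|l IHl r IHr] i //; rewrite bsplit_Nd.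
by case: ifP => _ /=; [have := IHl i | have := IHr (i - (sbt l).+1)]; lia.
Qed.

Lemma sbt_bsplit1 t i : i <= sbt t -> sbt (bsplit t i).1 = i.
Proof.
elim: t i => [|l IHl r IHr] i; first by case: i.
rewrite bsplit_Nd /= => hi; case: ifP => h /=; first exact: IHl.
by rewrite IHr; lia.
Qed.

Lemma sbt_bsplit2 t i : i <= sbt t -> sbt (bsplit t i).2 = sbt t - i.
Proof. by move=> /sbt_bsplit1 h; have := sbt_bsplit t i; lia. Qed.

Lemma bsplit0 t : bsplit t 0 = (Lf, t).
Proof. by elim: t => // l IHl r IHr; rewrite bsplit_Nd leq0n IHl. Qed.

Lemma bsplit_ge t i : sbt t <= i -> bsplit t i = (t, Lf).
Proof.
elim: t i => // l IHl r IHr i; rewrite bsplit_Nd /= => h.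
by rewrite ifF ?IHr //; lia.
Qed.

Lemma bsplit_over s t : bsplit (over s t) (sbt s) = (s, t).
Proof.
elim: s => [|l _ r IH] /=; first exact: bsplit0.
have -> : (sbt l + sbt r).+1 - (sbt l).+1 = sbt r by lia.
by rewrite ifF ?IH //; lia.
Qed.

(* Coassociativity of the splitting. *)
Lemma bsplitA1 t i j : (bsplit (bsplit t (i + j)).1 i).1 = (bsplit t i).1.
Proof.
elim: t i j => // l IHl r IHr i j; rewrite !bsplit_Nd.
case: (leqP (i + j) (sbt l)) => h1 /=.
  by rewrite IHl ifT //; lia.
rewrite -!/(bsplit (Nd _ _) _) bsplit_Nd; case: (leqP i (sbt l)) => h2 //=.
have -> : i + j - (sbt l).+1 = (i - (sbt l).+1) + j by lia.
by rewrite IHr.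
Qed.

Lemma bsplitA2 t i j : i <= sbt t ->
  (bsplit (bsplit t (i + j)).1 i).2 = (bsplit (bsplit t i).2 j).1.
Proof.
elim: t i j => [|l IHl r IHr] i j /=; first by [].
move=> hi; rewrite -!/(bsplit (Nd _ _) _) !bsplit_Nd.
case: (leqP (i + j) (sbt l)) => h1 /=.
  rewrite ifT /=; last by lia.
  rewrite -!/(bsplit (Nd _ _) _) bsplit_Nd sbt_bsplit2; last by lia.
  by rewrite ifT /= ?IHl //; lia.
rewrite -!/(bsplit (Nd _ _) _) bsplit_Nd; case: (leqP i (sbt l)) => h2 //=.
  rewrite -!/(bsplit (Nd _ _) _) bsplit_Nd sbt_bsplit2 // ifF /=; last by lia.
  by congr (Nd _ (bsplit r _).1); lia.
have -> : i + j - (sbt l).+1 = (i - (sbt l).+1) + j by lia.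
by rewrite IHr //; lia.
Qed.

Lemma bsplitA3 t i j : i <= sbt t ->
  (bsplit t (i + j)).2 = (bsplit (bsplit t i).2 j).2.
Proof.
elim: t i j => [|l IHl r IHr] i j /=; first by [].
move=> hi; rewrite -!/(bsplit (Nd _ _) _) !bsplit_Nd.
case: (leqP i (sbt l)) => h2 //=; last first.
  rewrite ifF /=; last by lia.
  have -> : i + j - (sbt l).+1 = (i - (sbt l).+1) + j by lia.
  by rewrite IHr //; lia.
rewrite -!/(bsplit (Nd _ _) _) bsplit_Nd sbt_bsplit2 //.
case: (leqP (i + j) (sbt l)) => h1 /=.
  by rewrite ifT /= ?IHl //; lia.
rewrite ifF /=; last by lia.
by congr (bsplit r _).2; lia.
Qed.

(** * The Tamari order *)

Lemma tleP s t : reflect (tamari_le s t) (tle s t).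
Proof. by rewrite /tle; case: excluded_middle_informative => h; constructor. Qed.

Lemma tamari_refl t : tamari_le t t.
Proof. exact: rt_refl. Qed.

Lemma tamari_trans t s u : tamari_le s t -> tamari_le t u -> tamari_le s u.
Proof. exact: rt_trans. Qed.

Lemma tamari_map (g : bt -> bt) :
    (forall s t, rot s t -> tamari_le (g s) (g t)) ->
  forall s t, tamari_le s t -> tamari_le (g s) (g t).
Proof.
move=> hg s t; elim=> {s t} [s t /hg //|s|s t u _ h1 _ h2].
  exact: tamari_refl.
exact: tamari_trans h1 h2.
Qed.

Lemma tamari_Nd l l' r r' :
  tamari_le l l' -> tamari_le r r' -> tamari_le (Nd l r) (Nd l' r').
Proof.
move=> hl hr; apply: (@tamari_trans (Nd l' r)).
  by apply: (tamari_map (g := Nd^~ r)) hl => s t st; apply/rt_step/rot_l.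
by apply: (tamari_map (g := Nd l')) hr => s t st; apply/rt_step/rot_r.
Qed.

Lemma tamari_over s s' t t' :
  tamari_le s s' -> tamari_le t t' -> tamari_le (over s t) (over s' t').
Proof.
move=> hs ht; apply: (@tamari_trans (over s' t)); last first.
  by elim: s' {hs} => //= l _ r IH; apply: tamari_Nd => //; apply: tamari_refl.
apply: (tamari_map (g := over^~ t)) hs => {s s'} s s'.
elim=> {s s'} [a b c|l l' r h _|l r r' h IH] /=.
- exact/rt_step/rot_root.
- exact/rt_step/rot_l.
- by apply: tamari_Nd => //; apply: tamari_refl.
Qed.

Lemma tamari_sbt s t : tamari_le s t -> sbt s = sbt t.
Proof.
elim=> {s t} [s t|//|s t u _ -> _ //].
by elim=> {s t} [a b c|l l' r _|l r r' _] /=; lia.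
Qed.

(** Rotate at the root, then continue inside the right subtree: one rotation for each node on the
    right branch of [x]. *)
Lemma tamari_Nd_over x y z : tamari_le (Nd (over x y) z) (over x (Nd y z)).
Proof.
elim: x => [|l _ r IH] /=; first exact: tamari_refl.
apply: (@tamari_trans (Nd l (Nd (over r y) z))).
  exact/rt_step/rot_root.
by apply: tamari_Nd => //; apply: tamari_refl.
Qed.

(** This is the unit of the adjunction in [tle_over]. When the leaf lies in the left subtree,
    [tamari_Nd_over] carries the root past the first part. *)
Lemma tamari_bsplit_over t i :
  tamari_le t (over (bsplit t i).1 (bsplit t i).2).
Proof.
elim: t i => [|l IHl r IHr] i; first exact: tamari_refl.
rewrite bsplit_Nd; case: ifP => _ /=; last first.
  by apply: tamari_Nd => //; apply: tamari_refl.
apply: tamari_trans (tamari_Nd_over _ _ _).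
by apply: tamari_Nd => //; apply: tamari_refl.
Qed.

(** For a rotation at the root, a leaf in [a] or in [c] leaves the rotation intact in one of the two
    parts; a leaf in [b] separates the two rotated nodes, and both trees split into the same
    pair. *)
Lemma rot_bsplit s t i : rot s t ->
  tamari_le (bsplit s i).1 (bsplit t i).1 /\
  tamari_le (bsplit s i).2 (bsplit t i).2.
Proof.
move=> st; elim: st i => {s t} [a b c|l l' r h IH|l r r' h IH] i.
- rewrite !bsplit_Nd [sbt (Nd a b)]/=.
  case: (leqP i (sbt a)) => h1; rewrite -!/(bsplit (Nd _ _) _).
    rewrite ifT /=; last by lia.
    by split; [apply: tamari_refl | apply/rt_step/rot_root].
  case: (leqP i (sbt a + sbt b).+1) => h2 /=.
    by rewrite ifT /=; [split; apply: tamari_refl | lia].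
  rewrite ifF /=; last by lia.
  have -> : i - (sbt a).+1 - (sbt b).+1 = i - (sbt a + sbt b).+2 by lia.
  by split; [apply/rt_step/rot_root | apply: tamari_refl].
- rewrite !bsplit_Nd (tamari_sbt (rt_step _ _ _ _ h)).
  case: ifP => _ /=; first by have [h1 h2] := IH i; split=> //;
    apply: tamari_Nd => //; apply: tamari_refl.
  by split; [apply/rt_step/rot_l | apply: tamari_refl].
- rewrite !bsplit_Nd; case: ifP => _ /=.
    by split; [apply: tamari_refl | apply/rt_step/rot_r].
  have [h1 h2] := IH (i - (sbt l).+1); split=> //.
  by apply: tamari_Nd => //; apply: tamari_refl.
Qed.

Lemma tamari_bsplit s t i : tamari_le s t ->
  tamari_le (bsplit s i).1 (bsplit t i).1 /\
  tamari_le (bsplit s i).2 (bsplit t i).2.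
Proof.
move=> st; split.
  by apply: (tamari_map (g := fun t => (bsplit t i).1)) st => ? ? /(rot_bsplit i)[].
by apply: (tamari_map (g := fun t => (bsplit t i).2)) st => ? ? /(rot_bsplit i)[].
Qed.

Lemma tle_refl t : tle t t.
Proof. exact/tleP/tamari_refl. Qed.

Lemma tle_sbt s t : tle s t -> sbt s = sbt t.
Proof. by move/tleP/tamari_sbt. Qed.

Lemma tle_trans t s u : tle s t -> tle t u -> tle s u.
Proof. by move=> /tleP st /tleP tu; apply/tleP/(tamari_trans st). Qed.

(* Splitting at leaf |u| is left adjoint to u, v |-> u \ v. *)
Lemma tle_over x u v : tle x (over u v) =
  tle (bsplit x (sbt u)).1 u && tle (bsplit x (sbt u)).2 v.
Proof.
apply/tleP/andP => [/(tamari_bsplit (sbt u))|[/tleP h1 /tleP h2]].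
  by rewrite bsplit_over => -[/tleP h1 /tleP h2].
exact: tamari_trans (tamari_bsplit_over x (sbt u)) (tamari_over h1 h2).
Qed.

Lemma tle_Lf x : tle x Lf = (x == Lf).
Proof.
apply/idP/eqP => [/tle_sbt/eqP|->]; last exact: tle_refl.
by rewrite sbt_eq0 => /eqP.
Qed.

Lemma tle_Lfl x : tle Lf x = (x == Lf).
Proof.
apply/idP/eqP => [/tle_sbt/esym/eqP|->]; last exact: tle_refl.
by rewrite sbt_eq0 => /eqP.
Qed.

(** No rotation produces a root with empty right subtree, except one inside the left subtree of such
    a root. A chain that ends in [Nd t Lf] therefore consists of rotations in the left subtree
    only. *)
Lemma tle_Nd_Lf l r t : tle (Nd l r) (Nd t Lf) = (r == Lf) && tle l t.
Proof.
apply/tleP/andP => [|[/eqP-> /tleP h]]; last by apply/tamari_Nd/tamari_refl.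
suff main x y : clos_refl_trans_1n _ rot x y -> forall t, y = Nd t Lf ->
    exists2 s, x = Nd s Lf & tamari_le s t.
  move=> h; have [s [-> ->] {}h] := main _ _ (clos_rt_rt1n _ _ _ _ h) _ erefl.
  by split=> //; apply/tleP.
elim=> {x y} [x t' ->|x y z xy _ IH t' /IH[s ys st]].
  by exists t' => //; apply: tamari_refl.
case: xy ys => [a b c|l1 l1' r1 h|l1 r1 r1' h] [e1 e2] //; last first.
  by rewrite e2 in h; inversion h.
exists l1; first by rewrite e2.
by apply: tamari_trans st; apply: rt_step; rewrite -e1.
Qed.

(** The sum over all nodes of the size of the right subtree. Every rotation raises it strictly,
    whence antisymmetry of the Tamari order. *)
Fixpoint rank (t : bt) : nat :=
  match t with Lf => 0 | Nd l r => rank l + rank r + sbt r end.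

Lemma tamari_rank s t : tamari_le s t -> s = t \/ rank s < rank t.
Proof.
elim=> {s t} [s t h|s|s t u _ h1 _ h2]; [right | by left |]; last first.
  case: h1 => [->//|h1]; case: h2 => [<-|h2]; first by right.
  by right; apply: ltn_trans h2.
elim: h => {s t} [a b c|l l' r h|l r r' h] /=; try by lia.
by rewrite (tamari_sbt (rt_step _ _ _ _ h)); lia.
Qed.

Lemma tle_anti s t : tle s t -> tle t s -> s = t.
Proof.
by move=> /tleP/tamari_rank[]// h1 /tleP/tamari_rank[]// h2; lia.
Qed.

(** In this form [phi] is the left-child right-sibling correspondence: children go to the left
    subtree, later siblings to the right one. *)
Lemma phi_cons ts f : phi (PNode ts :: f) = Nd (phi ts) (phi f).
Proof. by []. Qed.

Lemma phi_cat f g : phi (f ++ g) = over (phi f) (phi g).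
Proof. by elim: f => //= T f ->; rewrite overA. Qed.

(** * The product of YSym *)

(** Both sides run over the pairs [i <= j <= m]. On the right the inner index is the excess of [j]
    over [i], which is how coassociativity addresses a second splitting. *)
Lemma big_triangle (V : nmodType) (m : nat) (H : nat -> nat -> V) :
  (\sum_(0 <= j < m.+1) \sum_(0 <= i < j.+1) H i j =
   \sum_(0 <= i < m.+1) \sum_(0 <= j < (m - i).+1) H i (i + j)%N)%R.
Proof.
elim: m => [|m IH]; first by rewrite !big_nat1.
rewrite big_nat_recr //= IH [RHS]big_nat_recr //= subnn [in RHS]big_nat1 addn0.
rewrite [X in (_ + X)%R]big_nat_recr //= addrA -big_split /=; congr (_ + _)%R.
apply: eq_big_nat => i /andP[_ hi].
by rewrite subSn // [RHS]big_nat_recr //=; congr (_ + H _ _)%R; lia.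
Qed.

Lemma sum_msetsS (V : nmodType) q m (G : seq nat -> V) :
  (\sum_(js <- msets q.+1 m) G js =
   \sum_(0 <= i < m.+1) \sum_(s <- msets q i) G (i :: s))%R.
Proof. by rewrite big_flatten big_map; apply: eq_bigr => i _; rewrite big_map. Qed.

(** The element [i] in position [q1 + 1] by increasing size separates the multiset: [s1] holds the
    elements below it, and [s2] those above it, shifted down by [i]. *)
Lemma sum_msets (V : nmodType) q1 q2 m (G : seq nat -> V) :
  (\sum_(js <- msets (q2 + q1.+1) m) G js =
   \sum_(0 <= i < m.+1) \sum_(s1 <- msets q1 i) \sum_(s2 <- msets q2 (m - i))
     G (map (addn i) s2 ++ i :: s1))%R.
Proof.
elim: q2 m G => [|q2 IH] m G.
  rewrite add0n sum_msetsS; apply: eq_bigr => i _.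
  by apply: eq_bigr => s1 _; rewrite big_seq1.
rewrite addSn sum_msetsS.
under eq_bigr => j _ do rewrite IH.
rewrite big_triangle.
apply: eq_big_nat => i /andP[_ hi]; rewrite exchange_big /=.
apply: eq_bigr => s1 _; rewrite sum_msetsS.
apply: eq_bigr => j _; rewrite addKn.
exact: eq_bigr.
Qed.

Lemma size_msets q m js : js \in msets q m -> size js = q.
Proof.
elim: q m js => [|q IH] m js; first by rewrite inE => /eqP->.
by case/flattenP => _ /mapP[i _ ->] /mapP[s /IH hs ->] /=; rewrite hs.
Qed.

Lemma divide_cons t i js :
  divide t (i :: js) = rcons (divide (bsplit t i).1 js) (bsplit t i).2.
Proof. by rewrite /=; case: bsplit. Qed.

Lemma size_divide t js : size (divide t js) = (size js).+1.
Proof.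
elim: js t => // i js IH t.
by rewrite divide_cons size_rcons IH.
Qed.

(** By coassociativity the cut at [i] may be made first; the cuts of [s1] then act on the left part
    and those of [s2] on the right part. *)
Lemma divide_cat t i s1 s2 : i <= sbt t ->
  divide t (map (addn i) s2 ++ i :: s1) =
  divide (bsplit t i).1 s1 ++ divide (bsplit t i).2 s2.
Proof.
elim: s2 t => [|j s2 IH] t hi; first by rewrite [map _ _]/= cat0s divide_cons -cats1.
rewrite [map _ _]/= cat_cons !divide_cons IH.
  by rewrite bsplitA1 bsplitA2 // bsplitA3 // rcons_cat.
case: (leqP (i + j) (sbt t)) => h; first by rewrite sbt_bsplit1 //; lia.
by rewrite bsplit_ge //; lia.
Qed.

(* The trees in the expansion of the product F_a F_b, with multiplicity,
   by recursion on b: the leaf of a that goes to the root of b cuts a in two. *)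
Fixpoint prods (a b : bt) : seq bt :=
  match b with
  | Lf => [:: a]
  | Nd l r =>
    flatten [seq [seq Nd x y | x <- prods (bsplit a i).1 l,
                               y <- prods (bsplit a i).2 r]
            | i <- iota 0 (sbt a).+1]
  end.

Lemma sum_prods_Nd (V : nmodType) a l r (G : bt -> V) :
  (\sum_(x <- prods a (Nd l r)) G x =
   \sum_(0 <= i < (sbt a).+1) \sum_(x <- prods (bsplit a i).1 l)
     \sum_(y <- prods (bsplit a i).2 r) G (Nd x y))%R.
Proof.
rewrite big_flatten big_map; apply: eq_bigr => i _.
by rewrite big_allpairs_dep.
Qed.

Lemma sum_graft_divide (V : nmodType) a b (G : bt -> V) :
  (\sum_(js <- msets (sbt b) (sbt a)) G (graft b (divide a js)) =
   \sum_(x <- prods a b) G x)%R.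
Proof.
elim: b a G => [|l IHl r IHr] a G; first by rewrite /= !big_seq1.
(* The separating element has [sbt l] elements below it, so that the left part of [a] is divided
   into [(sbt l).+1] pieces, one for each leaf of [l]. *)
have -> : sbt (Nd l r) = sbt r + (sbt l).+1 by rewrite /=; lia.
rewrite sum_msets sum_prods_Nd; apply: eq_big_nat => i /andP[_ hi].
rewrite -IHl sbt_bsplit1 ?sbt_bsplit2 //.
rewrite big_seq [RHS]big_seq; apply: eq_bigr => s1 /size_msets hs1.
rewrite -IHr sbt_bsplit2 //; apply: eq_bigr => s2 _.
rewrite divide_cat // [graft (Nd _ _) _]/=.
have hs : size (divide (bsplit a i).1 s1) = (sbt l).+1.
  by rewrite size_divide hs1.
by rewrite -hs take_size_cat // drop_size_cat.
Qed.

Lemma sbt_prods a b x : x \in prods a b -> sbt x = sbt a + sbt b.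
Proof.
elim: b a x => [|l IHl r IHr] a x; first by rewrite inE => /eqP ->; rewrite addn0.
case/flattenP => _ /mapP[i _ ->] /allpairsPdep[y [z [/IHl hy /IHr hz ->]]] /=.
by have := sbt_bsplit a i; lia.
Qed.

(* Compatibility of the product of YSym with its coproduct, one degree at a time. *)
Lemma sum_prods_bsplit (V : nmodType) a b k (G : bt -> bt -> V) :
  k <= sbt a + sbt b ->
  (\sum_(x <- prods a b) G (bsplit x k).1 (bsplit x k).2 =
   \sum_(0 <= l < (sbt a).+1)
     if ((l <= k) && (k - l <= sbt b))%N then
       \sum_(x <- prods (bsplit a l).1 (bsplit b (k - l)).1)
         \sum_(y <- prods (bsplit a l).2 (bsplit b (k - l)).2) G x y
     else 0)%R.
Proof.
elim: b a k G => [|bl IHl br IHr] a k G.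
  rewrite [sbt Lf]/= addn0 => hk; rewrite big_seq1 -big_mkcond /=.
  rewrite (eq_bigl (pred1 k)) => [|l /=]; last by lia.
  by rewrite big_nat1_eq /= ltnS hk !big_seq1.
move=> hk; rewrite [sbt (Nd _ _)]/= in hk *.
rewrite sum_prods_Nd.
(* In a term of the product, [i] is the leaf of [a] sent to the root of [b], and [l] the leaf of [a]
   at which the splitting at [k] cuts [a]. [H] collects the terms whose leaf [k] lies in the left
   subtree, where [l <= i]; [K] those where it lies in the right subtree, where [i <= l]. *)
pose H l i : V := (if ((l <= k) && (k - l <= sbt bl))%N then
  \sum_(x0 <- prods (bsplit a l).1 (bsplit bl (k - l)).1)
  \sum_(x1 <- prods (bsplit (bsplit a i).1 l).2 (bsplit bl (k - l)).2)
  \sum_(y <- prods (bsplit a i).2 br) G x0 (Nd x1 y) else 0)%R.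
pose k' l := k - l - (sbt bl).+1.
pose K i l : V := (if ((l <= k) &&
    ((sbt bl).+1 <= k - l <= (sbt bl + sbt br).+1))%N then
  \sum_(x <- prods (bsplit a i).1 bl)
  \sum_(y0 <- prods (bsplit (bsplit a l).1 i).2 (bsplit br (k' l)).1)
  \sum_(y1 <- prods (bsplit a l).2 (bsplit br (k' l)).2) G (Nd x y0) y1 else 0)%R.
transitivity (\sum_(0 <= i < (sbt a).+1)
   ((\sum_(0 <= l < i.+1) H l i) +
    \sum_(0 <= l < (sbt a - i).+1) K i (i + l)%N))%R.
  apply: eq_big_nat => i /andP[_ hi].
  have hi1 := sbt_bsplit1 hi; have hi2 := sbt_bsplit2 hi.
  (* The left subtree [x] has size [i + sbt bl], which decides the subtree that contains leaf [k].
     In each case one induction hypothesis applies. *)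
  transitivity (\sum_(x <- prods (bsplit a i).1 bl)
      \sum_(y <- prods (bsplit a i).2 br)
      if (k <= i + sbt bl)%N then G (bsplit x k).1 (Nd (bsplit x k).2 y)
      else G (Nd x (bsplit y (k - (i + sbt bl).+1)%N).1)
             (bsplit y (k - (i + sbt bl).+1)%N).2)%R.
    rewrite big_seq [RHS]big_seq; apply: eq_bigr => x /sbt_prods hx.
    apply: eq_bigr => y _; rewrite bsplit_Nd hx hi1.
    by case: ifP.
  case: leqP => hki.
    rewrite [X in (_ + X)%R]big1 ?addr0 => [|l _]; last by rewrite /K ifF //; lia.
    rewrite (IHl _ _ (fun x0 x1 =>
      \sum_(y <- prods (bsplit a i).2 br) G x0 (Nd x1 y))%R); last by lia.
    rewrite hi1; apply: eq_big_nat => l /andP[_ hl]; rewrite /H.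
    have -> : (bsplit (bsplit a i).1 l).1 = (bsplit a l).1.
      by have -> : i = l + (i - l) by [lia]; rewrite bsplitA1.
    by [].
  rewrite [X in (X + _)%R]big1_seq ?add0r => [|l /andP[_]]; last first.
    by rewrite mem_index_iota /H => hl; rewrite ifF //; lia.
  under eq_bigr => x _ do
    (rewrite (IHr _ _ (fun y0 y1 => G (Nd x y0) y1)); last by lia).
  rewrite exchange_big hi2 /=; apply: eq_big_nat => l /andP[_ hl].
  rewrite /K.
  have -> : (i + l <= k) && (sbt bl < k - (i + l) <= (sbt bl + sbt br).+1) =
     (l <= k - (i + sbt bl).+1) && (k - (i + sbt bl).+1 - l <= sbt br) by lia.
  case: ifP => _; last by rewrite big1.
  apply: eq_bigr => x _.
  have -> : k' (i + l) = k - (i + sbt bl).+1 - l by rewrite /k'; lia.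
  by rewrite bsplitA2 // bsplitA3.
(* With [l] outermost, the root of [b] belongs to the second part of [b] when [k - l <= sbt bl] and
   to the first part otherwise. Expanding the product with that part gives the sum over [i] of [H],
   respectively of [K]. *)
rewrite big_split /= big_triangle -(big_triangle _ K) -big_split /=.
apply: eq_big_nat => l /andP[_ hl].
case: (boolP (l <= k)) => hlk; last first.
  by rewrite /= !big1 ?addr0 // => i _; rewrite ?/H ?/K (negbTE hlk).
rewrite -!/(bsplit (Nd _ _) _) bsplit_Nd /=.
case: (leqP (k - l) (sbt bl)) => hkl.
  rewrite [X in (_ + X)%R]big1 ?addr0 => [|i _]; last by rewrite /K ifF //; lia.
  rewrite ifT; last by lia.
  under [RHS]eq_bigr => x _ do rewrite sum_prods_Nd.
  rewrite [RHS]exchange_big /= sbt_bsplit2 //.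
  apply: eq_bigr => i _; rewrite /H hlk hkl /=.
  by rewrite bsplitA2 // -bsplitA3.
rewrite [X in (X + _)%R]big1 ?add0r => [|i _]; last by rewrite /H ifF //; lia.
case: ifP => hklv; last by rewrite big1 // => i _; rewrite /K hklv !andbF.
rewrite sum_prods_Nd sbt_bsplit1 //; apply: eq_big_nat => i /andP[_ hi].
rewrite /K hlk hkl hklv /=.
have -> : (bsplit (bsplit a l).1 i).1 = (bsplit a i).1.
  by have -> : l = i + (l - i) by [lia]; rewrite bsplitA1.
apply: eq_bigr => x _; exact: eq_bigr.
Qed.

(** * Admissible cuts *)

(* The pairs (f'_R, f''_R) for R admissible, with multiplicity. *)
Fixpoint tcuts (T : ptree) : seq (forest * forest) :=
  let: PNode ts := T in
  ([:: T], [::]) ::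
  [seq (c.1, [:: PNode c.2])
  | c <- (fix aux (ts : seq ptree) : seq (forest * forest) :=
            match ts with
            | [::] => [:: ([::], [::])]
            | T' :: ts' =>
              [seq (c.1 ++ d.1, c.2 ++ d.2) | c <- tcuts T', d <- aux ts']
            end) ts].

Fixpoint cuts (f : forest) : seq (forest * forest) :=
  match f with
  | [::] => [:: ([::], [::])]
  | T :: f' => [seq (c.1 ++ d.1, c.2 ++ d.2) | c <- tcuts T, d <- cuts f']
  end.

Lemma tcutsE ts : tcuts (PNode ts) =
  ([:: PNode ts], [::]) :: [seq (c.1, [:: PNode c.2]) | c <- cuts ts].
Proof. by []. Qed.

(** The forests [ts] and [f] correspond to the two subtrees of [phi (PNode ts :: f)], so this is
    induction on binary trees carried over to forests; it also handles the nesting of [ptree] in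
    [seq]. *)
Lemma forest_ind (P : forest -> Prop) :
    P [::] -> (forall ts f, P ts -> P f -> P (PNode ts :: f)) ->
  forall f, P f.
Proof.
move=> P0 PS f; have [n] := ubnP (sbt (phi f)).
elim: n f => // n IH [|[ts] f] // hf.
by rewrite phi_cons /= in hf; apply: PS; apply: IH; lia.
Qed.

Lemma sbt_cuts f c : c \in cuts f -> sbt (phi c.1) + sbt (phi c.2) = sbt (phi f).
Proof.
elim/forest_ind: f c => [|ts f IHts IHf] c; first by rewrite inE => /eqP->.
case/allpairsPdep=> c1 [c2 [hc1 /IHf hc2 ->]].
rewrite phi_cons /= !phi_cat !sbt_over -hc2.
suff : sbt (phi c1.1) + sbt (phi c1.2) = (sbt (phi ts)).+1 by rewrite addnACA => ->.
move: hc1; rewrite tcutsE inE => /orP[/eqP->|/mapP[d /IHts <- ->]] /=.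
  by rewrite -/(phi ts) !addn0.
by rewrite -/(phi d.2) addn0 addnS.
Qed.

Lemma sbt_tcuts T c : c \in tcuts T ->
  sbt (phi c.1) + sbt (phi c.2) = sbt (phi_tree T).
Proof.
case: T => ts hc.
rewrite -[phi_tree _]/(phi [:: PNode ts]) -(@sbt_cuts [:: PNode ts] c) //.
apply/allpairsPdep; exists c, ([::], [::]); split=> //=.
by rewrite !cats0; case: c hc.
Qed.

(** * Terms of a product below a given tree *)

Local Open Scope ring_scope.

(** By [tle_Nd_Lf] a term below [Nd t Lf] has empty right subtree. If [b = Nd l r], this forces
    [r = Lf] and sends all of [a] to the left, so only the last cut [i = sbt a] contributes. *)
Lemma sum_prods_tree (h : bt -> bt -> rat) t a b :
  (forall a b, \sum_(x <- prods a b) (tle x t)%:R = h a b) ->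
  \sum_(x <- prods a b) (tle x (Nd t Lf))%:R =
  if b is Nd l r then (r == Lf)%:R * h a l else (tle a (Nd t Lf))%:R.
Proof.
move=> hE; case: b => [|l r]; first by rewrite big_seq1.
rewrite sum_prods_Nd big_nat_recr //= big1_seq ?add0r => [|i /andP[_]].
  rewrite bsplit_ge // -hE mulr_sumr; apply: eq_bigr => x _ /=.
  case: r => [|rl rr]; first by rewrite big_seq1 tle_Nd_Lf mul1r.
  rewrite mul0r big_seq big1 // => y /sbt_prods hy.
  by rewrite tle_Nd_Lf -sbt_eq0 hy.
rewrite mem_index_iota => /andP[_ hi]; rewrite big1 // => x _.
rewrite big_seq big1 // => y /sbt_prods hy.
by rewrite tle_Nd_Lf -sbt_eq0 hy (sbt_bsplit2 (ltnW hi)) addn_eq0 subn_eq0 leqNgt hi.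
Qed.

Lemma count_prods_cuts a b f :
  \sum_(x <- prods a b) (tle x (phi f))%:R =
  \sum_(c <- cuts f) (tle a (phi c.1) && tle b (phi c.2))%:R :> rat.
Proof.
elim/forest_ind: f a b => [|ts f IHts IHf] a b.
  rewrite big_seq1 /=.
  under eq_bigr => x _ do rewrite tle_Lf.
  rewrite !tle_Lf; case: b => [|l r]; first by rewrite big_seq1 andbT.
  rewrite andbF big_seq big1 // => x /sbt_prods hx.
  by rewrite -sbt_eq0 hx /= addnS.
(* The cut that takes the root accounts for [b' = Lf]. Every other cut keeps the root, with nothing
   to its right, and accounts for [b' = Nd l Lf]. *)
have tree a' b' : \sum_(x <- prods a' b') (tle x (Nd (phi ts) Lf))%:R =
    \sum_(c <- tcuts (PNode ts)) (tle a' (phi c.1) && tle b' (phi c.2))%:R :> rat.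
  rewrite (sum_prods_tree _ _ IHts) tcutsE big_cons big_map /= -/(phi ts) tle_Lf.
  case: b' => [|l r] /=.
    by rewrite andbT big1 ?addr0 // => c _; rewrite -/(phi c.2) tle_Lfl andbF.
  rewrite andbF add0r mulr_sumr; apply: eq_bigr => c _.
  by rewrite -/(phi c.2) tle_Nd_Lf; case: eqP; rewrite ?mul1r ?mul0r ?andbF.
pose u := Nd (phi ts) Lf.
have phiE : phi (PNode ts :: f) = over u (phi f) by [].
(* Comparable trees have equal size, so both sides vanish unless the degrees agree. The agreement
   puts leaf [sbt u] in range for the splitting below. *)
have [hab|hab] := eqVneq (sbt a + sbt b)%N (sbt (phi (PNode ts :: f))); last first.
  rewrite big_seq big1 => [|x /sbt_prods hx]; last first.
    by case: (boolP (tle x _)) => // /tle_sbt e; rewrite -e hx eqxx in hab.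
  rewrite big_seq big1 // => c /sbt_cuts hc.
  by case: andP => // -[/tle_sbt e1 /tle_sbt e2]; rewrite e1 e2 hc eqxx in hab.
transitivity (\sum_(x <- prods a b)
    (tle (bsplit x (sbt u)).1 u)%:R * (tle (bsplit x (sbt u)).2 (phi f))%:R : rat).
  by apply: eq_bigr => x _; rewrite phiE tle_over -mulnb natrM.
rewrite (sum_prods_bsplit (fun x y => (tle x u)%:R * (tle y (phi f))%:R)); last first.
  by rewrite hab phiE sbt_over leq_addr.
rewrite [RHS]big_allpairs_dep /=.
(* The contribution of a cut [c] of the first tree and a cut [d] of the rest, when [a] is split at
   [l] and [b] at [sbt u - l]. *)
pose P c d l : rat := if (l <= sbt u)%N && (sbt u - l <= sbt b)%N then
  (tle (bsplit a l).1 (phi c.1) && tle (bsplit b (sbt u - l)).1 (phi c.2))%:R *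
  (tle (bsplit a l).2 (phi d.1) && tle (bsplit b (sbt u - l)).2 (phi d.2))%:R
  else 0.
transitivity (\sum_(0 <= l < (sbt a).+1)
  \sum_(c <- tcuts (PNode ts)) \sum_(d <- cuts f) P c d l).
  apply: eq_bigr => l _; rewrite /P; case: ifP => _; last first.
    by rewrite big1 // => c _; rewrite big1.
  under eq_bigr => x _ do rewrite -mulr_sumr IHf.
  rewrite -mulr_suml tree mulr_suml; apply: eq_bigr => c _.
  by rewrite mulr_sumr.
rewrite exchange_big /= big_seq [RHS]big_seq; apply: eq_bigr => c.
move/(@sbt_tcuts (PNode ts)).
rewrite -[phi_tree _]/u; set n1 := sbt (phi c.1); set n2 := sbt (phi c.2) => hc.
rewrite exchange_big /=; apply: eq_bigr => d _.
rewrite !phi_cat !tle_over -/n1 -/n2.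
(* [Q] is the condition for the concatenated cut, unfolded by the adjunction. It splits [a] at [n1],
   and comparing sizes shows that [l = n1] is the only index at which [P c d l] can be nonzero. *)
set Q := (X in (nat_of_bool X)%:R).
transitivity (\sum_(0 <= l < (sbt a).+1) if l == n1 then Q%:R else 0 : rat).
  apply: eq_big_nat => l /andP[_ hl]; rewrite /P -hc; case: eqVneq => [->|hln].
    rewrite leq_addr addKn /=; case: leqP => h2; last first.
      suff /negbTE-> : ~~ Q by [].
      apply: contraL h2 => /andP[_ /andP[/tle_sbt + _]].
      by rewrite -leqNgt -/n2 => <-; rewrite -(sbt_bsplit b n2) leq_addr.
    rewrite -natrM mulnb /Q; congr (nat_of_bool _)%:R.
    by rewrite -!andbA; do !bool_congr.
  case: ifP => // _; case: andP => [[/tle_sbt + _]|_]; last by rewrite mul0r.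
  by rewrite sbt_bsplit1 // => e; rewrite e eqxx in hln.
(* If [n1] exceeds [sbt a], no index is left; then [Q] fails too, since a part of [a] is not larger
   than [a]. *)
rewrite -big_mkcond big_nat1_eq /= ltnS; case: leqP => // h.
suff /negbTE-> : ~~ Q by [].
apply: contraL h => /andP[/andP[/tle_sbt + _] _].
by rewrite -leqNgt -/n1 => <-; rewrite -(sbt_bsplit a n1) leq_addr.
Qed.

(** * Admissible sets of nodes as sublists *)

Fixpoint subs (T : Type) (L : seq T) : seq (seq T) :=
  if L is a :: L' then subs L' ++ map (cons a) (subs L') else [:: [::]].

Lemma size_subs (T : Type) (L : seq T) : size (subs L) = (2 ^ size L)%N.
Proof. by elim: L => //= a L IH; rewrite size_cat size_map IH expnS mul2n addnn. Qed.

Lemma mem_subs (T : eqType) (L l : seq T) : l \in subs L -> {subset l <= L}.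
Proof.
elim: L l => [|a L IH] l /=; first by rewrite inE => /eqP->.
rewrite mem_cat => /orP[/IH h x /h|/mapP[l' /IH h ->] x].
  by rewrite inE orbC => ->.
by rewrite !inE => /orP[->//|/h->]; rewrite orbT.
Qed.

Lemma filter_subs (T : eqType) (p : pred T) (L : seq T) : filter p L \in subs L.
Proof.
elim: L => //= a L IH; rewrite mem_cat; case: ifP => _; last by rewrite IH.
by rewrite map_f ?orbT.
Qed.

Lemma sum_subs_cons (V : nmodType) (T : Type) a (L : seq T) (H : seq T -> V) :
  \sum_(l <- subs (a :: L)) H l =
  \sum_(l <- subs L) H l + \sum_(l <- subs L) H (a :: l).
Proof. by rewrite big_cat big_map. Qed.

(** This factorisation is the reason for using sublists: the node list of a forest is the
    concatenation of those of its first tree and of the rest. *)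
Lemma sum_subs_cat (V : nmodType) (T : Type) (L1 L2 : seq T) (H : seq T -> V) :
  \sum_(l <- subs (L1 ++ L2)) H l =
  \sum_(l1 <- subs L1) \sum_(l2 <- subs L2) H (l1 ++ l2).
Proof.
elim: L1 H => [|a L1 IH] H /=; first by rewrite big_seq1.
by rewrite !big_cat !big_map /= !IH.
Qed.

Lemma subs_map (T U : Type) (h : T -> U) (L : seq T) :
  subs (map h L) = map (map h) (subs L).
Proof. by elim: L => //= a L ->; rewrite map_cat -!map_comp. Qed.

(** A list without repetitions is the only one of its sublists to contain all its entries. This will
    isolate the admissible set that contains the root. *)
Lemma sum_subs_full (V : nmodType) (T : eqType) (L : seq T) (g : V) : uniq L ->
  \sum_(l <- subs L) (if all (mem l) L then g else 0) = g.
Proof.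
elim: L => [|a L IH] /=; first by rewrite big_seq1.
case/andP=> aL /IH {}IH; rewrite big_cat big_map /= big_seq big1 ?add0r.
  rewrite -[RHS]IH; apply: eq_bigr => l _; rewrite inE eqxx /=.
  congr (if _ then _ else _); apply: eq_in_all => x xL; rewrite /= inE.
  by case: eqP => // xa; rewrite xa (negbTE aL) in xL.
by move=> l /mem_subs h; rewrite (contraNF (h a) aL).
Qed.

(** Filtering [L] by a set of positions is injective and lands in [subs L]. Both sides have
    [2 ^ size L] elements, so it is a bijection. *)
Lemma sum_set_subs (V : nmodType) (T : eqType) (x0 : T) (L : seq T)
    (F : pred T -> V) : uniq L -> (forall R R', R =1 R' -> F R = F R') ->
  \sum_(S : {set 'I_(size L)}) F (fun a => [exists i in S, nth x0 L i == a]) =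
  \sum_(l <- subs L) F (mem l).
Proof.
move=> uL Fext.
pose R (S : {set 'I_(size L)}) a := [exists i in S, nth x0 L i == a].
pose g S := filter (R S) L.
have RE S (i : 'I_(size L)) : R S (nth x0 L i) = (i \in S).
  apply/existsP/idP => [[j /andP[jS]]|iS]; last by exists i; rewrite iS eqxx.
  by rewrite nth_uniq // => /eqP/val_inj <-.
have gE S : R S =1 mem (g S).
  move=> a; rewrite /= mem_filter andb_idr // => /existsP[i /andP[_ /eqP <-]].
  by rewrite mem_nth.
have g_inj : injective g.
  move=> S S' e; apply/setP => i; rewrite -!RE !gE /= e //.
have ug : uniq (map g (index_enum {set 'I_(size L)})).
  by rewrite map_inj_uniq // index_enum_uniq.
have sub_g : {subset map g (index_enum {set 'I_(size L)}) <= subs L}.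
  by move=> _ /mapP[S _ ->]; apply: filter_subs.
have sz : (size (subs L) <= size (map g (index_enum {set 'I_(size L)})))%N.
  rewrite size_subs size_map -[X in (2 ^ X)%N]card_ord -cardsT -card_powerset.
  by rewrite powersetT cardsT cardE enumT [index_enum _]unlock.
have [_ mem_g] := uniq_min_size ug sub_g sz.
have us : uniq (subs L) by apply: leq_size_uniq ug sub_g sz.
rewrite -(perm_big _ (uniq_perm ug us mem_g)) big_map.
by apply: eq_bigr => S _; apply/Fext/gE.
Qed.

(** The condition of [admissible] with the list of addresses as a parameter, so that it also covers
    a single tree and a tail of a forest. *)
Definition descendant_closed (L : seq (seq nat)) (R : pred (seq nat)) :=
  all (fun a => all (fun b => (R a && prefix a b) ==> R b) L) L.

Lemma descendant_closedP (L : seq (seq nat)) (R : pred (seq nat)) :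
  reflect {in L &, forall a b, R a -> prefix a b -> R b} (descendant_closed L R).
Proof.
apply: (iffP allP) => [h a b aL bL Ra ab|h a aL].
  by have /allP/(_ b bL)/implyP-> := h a aL; rewrite // Ra ab.
by apply/allP => b bL; apply/implyP => /andP[]; apply: h.
Qed.

Lemma eq_descendant_closed L R R' :
  R =1 R' -> descendant_closed L R = descendant_closed L R'.
Proof. by move=> e; apply: eq_all => a; apply: eq_all => b; rewrite !e. Qed.

(** Only addresses that extend the current one are tested. This allows the index of a tree within
    its forest to be dropped. *)
Lemma eq_tcut R R' a a' T :
  (forall b, R (a ++ b) = R' (a' ++ b)) -> tcut R a T = tcut R' a' T.
Proof.
(* A copy of the fixpoint nested in [tcut], with the predicate and the address as arguments, since
   both vary in the induction. *)
pose aux := fix aux R a (i : nat) (ts : seq ptree) : seq (forest * forest) :=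
  match ts with
  | [::] => [::]
  | T' :: ts' => tcut R (rcons a i) T' :: aux R a i.+1 ts'
  end.
have tcutE S c ts : tcut S c (PNode ts) =
    if S c then ([:: PNode ts], [::])
    else (flatten (map fst (aux S c 0%N ts)),
          [:: PNode (flatten (map snd (aux S c 0%N ts)))]).
  rewrite /=; set aux' := (fix aux (i : nat) (ts : seq ptree) {struct ts} := _).
  suff e i : aux' i ts = aux S c i ts by rewrite e.
  by elim: ts i => //= T' ts IH i; rewrite IH.
case: T => ts hR.
suff main f i S S' c c' : (forall b, S (c ++ b) = S' (c' ++ b)) ->
    aux S c i f = aux S' c' i f.
  by rewrite !tcutE (main _ _ _ _ _ _ hR); have := hR [::]; rewrite !cats0 => ->.
elim/forest_ind: f i S S' c c' => // us f IHus IHf i S S' c c' hS.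
rewrite -[LHS]/(tcut S (rcons c i) (PNode us) :: aux S c i.+1 f).
rewrite -[RHS]/(tcut S' (rcons c' i) (PNode us) :: aux S' c' i.+1 f).
congr cons; last exact: IHf.
have hS' b : S (rcons c i ++ b) = S' (rcons c' i ++ b) by rewrite !cat_rcons.
rewrite !tcutE (IHus _ _ _ _ _ hS').
by have := hS' [::]; rewrite !cats0 => ->.
Qed.

Lemma eq_fcut_from R R' i f :
    (forall j b, (i <= j)%N -> R (j :: b) = R' (j :: b)) ->
  fcut_from R i f = fcut_from R' i f.
Proof.
elim: f i => //= T f IH i hR; congr cons.
  by apply: eq_tcut => b; apply: hR.
by apply: IH => j b hj; apply: hR; apply: ltnW.
Qed.

Definition flatten_cuts (cs : seq (forest * forest)) : forest * forest :=
  (flatten (map fst cs), flatten (map snd cs)).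

Lemma tcut_root R ts : tcut R [::] (PNode ts) =
  if R [::] then ([:: PNode ts], [::])
  else ((fcut R ts).1, [:: PNode (fcut R ts).2]).
Proof.
rewrite /fcut /=; set aux := (fix aux (i : nat) (ts : seq ptree) {struct ts} := _).
suff e i : aux i ts = fcut_from R i ts by rewrite e.
by elim: ts i => //= T' ts IH i; rewrite IH.
Qed.

Lemma tnodesE ts : tnodes (PNode ts) = [::] :: fnodes ts.
Proof.
rewrite /fnodes /=; set aux := (fix aux (i : nat) (ts : seq ptree) {struct ts} := _).
suff e i : aux i ts = fnodes_from i ts by rewrite e.
by elim: ts i => //= T' ts IH i; rewrite IH.
Qed.

Lemma fnodes_from_head i f a : a \in fnodes_from i f ->
  exists j b, (i <= j)%N /\ a = j :: b.
Proof.
elim: f i => //= T f IH i; rewrite mem_cat => /orP[/mapP[b _ ->]|/IH].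
  by exists i, b.
by case=> j [b [hj ->]]; exists j, b; split=> //; apply: ltnW.
Qed.

Lemma fnodes_from_cons i T f :
  fnodes_from i (T :: f) = map (cons i) (tnodes T) ++ fnodes_from i.+1 f.
Proof. by []. Qed.

Lemma flatten_cuts_cons R i T f :
  flatten_cuts (fcut_from R i (T :: f)) =
  ((tcut R [:: i] T).1 ++ (flatten_cuts (fcut_from R i.+1 f)).1,
   (tcut R [:: i] T).2 ++ (flatten_cuts (fcut_from R i.+1 f)).2).
Proof. by []. Qed.

Lemma fnodes_from_uniq i f : uniq (fnodes_from i f).
Proof.
elim/forest_ind: f i => // ts f IHts IHf i.
rewrite fnodes_from_cons tnodesE cat_uniq IHf andbT.
rewrite map_inj_uniq => [|? ? []//]; apply/andP; split.
  rewrite /= IHts andbT; apply/negP => /fnodes_from_head.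
  by case=> j [b []].
apply/hasPn => a /fnodes_from_head[j [b [hj ->]]].
by apply/mapP => -[c _ [e _]]; rewrite e ltnn in hj.
Qed.

Lemma nck_degE f : nck_deg f = sbt (phi f).
Proof.
rewrite /nck_deg /fnodes; elim/forest_ind: f 0%N => // ts f IHts IHf i.
rewrite fnodes_from_cons tnodesE size_cat size_map IHf.
by rewrite phi_cons /= IHts.
Qed.

Lemma sum_admissible_tree (V : nmodType) ts (G : forest * forest -> V) :
  (forall G : forest * forest -> V, \sum_(l <- subs (fnodes ts))
    (if descendant_closed (fnodes ts) (mem l) then G (fcut (mem l) ts) else 0) =
    \sum_(c <- cuts ts) G c) ->
  \sum_(l <- subs (tnodes (PNode ts)))
    (if descendant_closed (tnodes (PNode ts)) (mem l)
     then G (tcut (mem l) [::] (PNode ts)) else 0) =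
  \sum_(c <- tcuts (PNode ts)) G c.
Proof.
move=> IH; rewrite tcutsE big_cons big_map tnodesE sum_subs_cons [LHS]addrC.
have nil0 : [::] \notin fnodes ts.
  by apply/negP => /fnodes_from_head[j [b []]].
(* Sets with the root: closure under descendants forces all nodes. *)
congr (_ + _).
  rewrite -[RHS](sum_subs_full _ (fnodes_from_uniq 0 ts)).
  apply: eq_bigr => l _.
  rewrite [tcut _ _ _](_ : _ = ([:: PNode ts], [::])) ?tcut_root //.
  congr (if _ then _ else _); apply/descendant_closedP/allP => [h a al|h a b].
    have := h [::] a; rewrite !inE al orbT => /(_ isT isT isT (prefix0s _)).
    by case/orP => // /eqP e; rewrite -e /fnodes al in nil0.
  rewrite !inE => _ /orP[/eqP->|bl] _ _; first by rewrite eqxx.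
  by rewrite [b \in l]h ?orbT.
(* Sets without the root: these are the admissible sets of the forest of children. *)
rewrite -(IH (fun c => G (c.1, [:: PNode c.2]))) big_seq [RHS]big_seq.
apply: eq_bigr => l /mem_subs hl.
have nl : [::] \in l = false by apply: contraNF nil0; apply: hl.
rewrite tcut_root [(mem l) [::]]nl.
congr (if _ then _ else _); apply/descendant_closedP/descendant_closedP => h a b.
  by move=> aL bL; apply: h; rewrite inE ?aL ?bL orbT.
rewrite !inE => /orP[/eqP->|aL]; first by rewrite /= nl.
case/orP => [/eqP->|bL]; last exact: h.
by case: a aL => // aL; rewrite aL in nil0.
Qed.

(** No node of the first tree is a prefix of a node of the rest or conversely, so an admissible set
    is an independent choice of one in each. The start index [i] is general because the tail of a
    forest keeps its numbering. *)
Lemma sum_admissible (V : nmodType) i f (G : forest * forest -> V) :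
  \sum_(l <- subs (fnodes_from i f))
    (if descendant_closed (fnodes_from i f) (mem l)
     then G (flatten_cuts (fcut_from (mem l) i f)) else 0) =
  \sum_(c <- cuts f) G c.
Proof.
elim/forest_ind: f i G => [|ts f IHts IHf] i G; first by rewrite !big_seq1.
have {}IHts := sum_admissible_tree _ (IHts 0%N).
rewrite -[cuts (_ :: _)]/(allpairs _ _ _) big_allpairs_dep fnodes_from_cons.
rewrite -IHts sum_subs_cat subs_map big_map.
apply: eq_bigr => m _; rewrite big_seq.
set T := PNode ts; set L := fnodes_from i.+1 f.
transitivity (\sum_(l <- subs L | l \in subs L)
  if descendant_closed (tnodes T) (mem m) then
    if descendant_closed L (mem l) then
      let d := flatten_cuts (fcut_from (mem l) i.+1 f) in
      G ((tcut (mem m) [::] T).1 ++ d.1, (tcut (mem m) [::] T).2 ++ d.2) else 0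
    else 0); last first.
  rewrite -big_seq; case: ifP => _; last by rewrite big1.
  exact: (IHf i.+1 (fun d => G ((tcut (mem m) [::] T).1 ++ d.1, _))).
apply: eq_bigr => l /mem_subs hl.
have lhead a : a \in L -> exists j b, (i < j)%N /\ a = j :: b.
  exact: fnodes_from_head.
(* The first index of an address tells the two halves of the set apart: [i] for the first tree,
   larger values for the rest. *)
have R1 b : (i :: b \in map (cons i) m ++ l) = (b \in m).
  rewrite mem_cat mem_map => [|? ? []//]; case: (b \in m) => //=.
  by apply/negP => /hl/lhead[j [c [hj [e _]]]]; rewrite e ltnn in hj.
have R2 j b : (i < j)%N -> (j :: b \in map (cons i) m ++ l) = (j :: b \in l).
  move=> hj; rewrite mem_cat; case: mapP => // -[c _ [e _]].
  by rewrite e ltnn in hj.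
rewrite flatten_cuts_cons.
have -> : tcut (mem (map (cons i) m ++ l)) [:: i] T = tcut (mem m) [::] T.
  exact: eq_tcut.
have -> : fcut_from (mem (map (cons i) m ++ l)) i.+1 f = fcut_from (mem l) i.+1 f.
  exact: eq_fcut_from.
have -> : descendant_closed (map (cons i) (tnodes T) ++ L)
    (mem (map (cons i) m ++ l)) =
    descendant_closed (tnodes T) (mem m) && descendant_closed L (mem l).
  apply/descendant_closedP/andP => [h|[/descendant_closedP h1 /descendant_closedP h2]].
    split; apply/descendant_closedP => a b aL bL.
      rewrite /= -!R1 => ha hab; apply: (h (i :: a) (i :: b)) => //.
      - by rewrite mem_cat map_f.
      - by rewrite mem_cat map_f.
      - by rewrite /= eqxx.
    have [[j [a' [hj ea]]] [j' [b' [hj' eb]]]] := (lhead _ aL, lhead _ bL).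
    have := h a b; rewrite !mem_cat aL bL !orbT => /(_ isT isT).
    by rewrite ea eb /= !R2.
  move=> a b; rewrite !mem_cat.
  case/orP=> [/mapP[a' aT ->]|aL]; case/orP=> [/mapP[b' bT ->]|bL] /=.
  - by rewrite !R1 eqxx; apply: h1.
  - have [j [b' [hj ->]]] := lhead _ bL; rewrite /= => _.
    by case: eqP => // e; rewrite e ltnn in hj.
  - have [j [a' [hj ->]]] := lhead _ aL; rewrite /= => _.
    by case: eqP => // e; rewrite e ltnn in hj.
  - have [[j [a' [hj ea]]] [j' [b' [hj' eb]]]] := (lhead _ aL, lhead _ bL).
    by have := h2 a b aL bL; rewrite ea eb /= !R2.
by do 2!case: descendant_closed.
Qed.

Lemma nck_cop_basisE f : nck_cop_basis f = \sum_(c <- cuts f) << c >>.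
Proof.
rewrite -(sum_admissible 0) /nck_cop_basis big_mkcond /=.
apply: (@sum_set_subs _ _ [::] _
  (fun R => if admissible f R then << fcut R f >> else 0)).
  exact: fnodes_from_uniq.
move=> R R' e.
have -> : admissible f R = admissible f R' by apply: eq_descendant_closed.
by rewrite /fcut (@eq_fcut_from R R' 0).
Qed.

(** * Linear extensions *)

(** Coefficients outside the support vanish, so elements with different supports can be summed over
    a common finite set. *)
Lemma lextEw (X : choiceType) (V : lmodType rat) (g : X -> V) (x : Free X)
    (d : {fset X}) : (msupp x `<=` d)%fset ->
  lext g x = \sum_(k <- d) x@_k *: g k.
Proof.
move=> hd; apply: big_fset_incl => // k _ /mcoeff_outdom ->.
by rewrite scale0r.
Qed.

Lemma lext_is_linear (X : choiceType) (V : lmodType rat) (g : X -> V) :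
  linear (lext g).
Proof.
move=> c x y; pose d := (msupp x `|` msupp y)%fset.
have hx : (msupp x `<=` d)%fset by apply: fsubsetUl.
have hy : (msupp y `<=` d)%fset by apply: fsubsetUr.
have hxy : (msupp (c *: x + y) `<=` d)%fset.
  apply: (fsubset_trans (msuppD_le _ _)).
  by rewrite fsubUset hy (fsubset_trans (msuppZ_le _ _) hx).
rewrite (lextEw g hx) (lextEw g hy) (lextEw g hxy) scaler_sumr -big_split /=.
by apply: eq_bigr => k _; rewrite mcoeffD mcoeffZ scalerDl scalerA.
Qed.

HB.instance Definition _ (X : choiceType) (V : lmodType rat) (g : X -> V) :=
  GRing.isLinear.Build rat (Free X) V *:%R (lext g) (lext_is_linear g).

Lemma lextU (X : choiceType) (V : lmodType rat) (g : X -> V) k :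
  lext g << k >> = g k.
Proof.
rewrite (lextEw g (d := [fset k]%fset)) ?msuppU_le //.
by rewrite big_seq_fset1 mcoeffUU scale1r.
Qed.

Lemma eq_lext (X : choiceType) (V : lmodType rat) (g h : X -> V) :
  g =1 h -> lext g =1 lext h.
Proof. by move=> e x; apply: eq_bigr => k _; rewrite e. Qed.

Lemma lext_id (X : choiceType) (x : Free X) : lext (fun k => << k >>) x = x.
Proof.
rewrite [RHS]monalgE; apply: eq_bigr => k _; apply/malgP => k'.
by rewrite mcoeffZ !mcoeffU mulrnAr mulr1.
Qed.

Lemma lext_comp (X Y : choiceType) (V : lmodType rat) (g : Y -> V)
    (h : X -> Free Y) x :
  lext g (lext h x) = lext (fun k => lext g (h k)) x.
Proof.
by rewrite [lext h x]/lext linear_sum; apply: eq_bigr => k _; rewrite linearZ.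
Qed.

Lemma mcoeff_lext (X Y : choiceType) (h : X -> Free Y) x k :
  (lext h x)@_k = \sum_(i <- msupp x) x@_i * (h i)@_k.
Proof. by rewrite raddf_sum; apply: eq_bigr => i _; rewrite /= mcoeffZ. Qed.

Lemma bilextE (X Y Z : choiceType) (m : X -> Y -> Free Z) x y :
  bilext m x y = lext (fun a => lext (m a) y) x.
Proof.
apply: eq_bigr => a _; rewrite scaler_sumr; apply: eq_bigr => b _.
by rewrite scalerA.
Qed.

Lemma bilextEr (X Y Z : choiceType) (m : X -> Y -> Free Z) x y :
  bilext m x y = lext (fun b => lext (m^~ b) x) y.
Proof.
rewrite /bilext exchange_big; apply: eq_bigr => b _; rewrite scaler_sumr.
by apply: eq_bigr => a _; rewrite scalerA mulrC.
Qed.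

Lemma bilext_lext (X X' Y Y' Z : choiceType) (m : X -> Y -> Free Z)
    (g : X' -> Free X) (h : Y' -> Free Y) x y :
  bilext m (lext g x) (lext h y) = bilext (fun a b => bilext m (g a) (h b)) x y.
Proof.
rewrite bilextE lext_comp [RHS]bilextE; apply: eq_lext => a.
by rewrite -bilextE bilextEr lext_comp; apply: eq_lext => b; rewrite -bilextEr.
Qed.

Lemma mcoeff_basis (X : choiceType) (k k' : X) :
  (<< k >> : Free X)@_k' = (k == k')%:R.
Proof. exact: mcoeffU. Qed.

Lemma sum_delta (T : eqType) (r : seq T) s (F : T -> rat) : uniq r ->
  \sum_(u <- r) F u * (u == s)%:R = if s \in r then F s else 0.
Proof.
move=> ur; case: ifP => sr.
  rewrite (bigD1_seq s) //= eqxx mulr1 big1 ?addr0 // => u /negbTE->.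
  by rewrite mulr0.
rewrite big1_seq // => u /andP[_ ur']; case: eqP => [e|]; last by rewrite mulr0.
by rewrite -e ur' in sr.
Qed.

Lemma mcoeff_tensv (X Y : choiceType) (x : Free X) (y : Free Y) a b :
  (tensv x y)@_(a, b) = x@_a * y@_b.
Proof.
have cE (Z : choiceType) (z : Free Z) c :
    \sum_(k <- msupp z) z@_k * (k == c)%:R = z@_c.
  by rewrite sum_delta ?fset_uniq //; case: ifP => // /negbT/mcoeff_outdom.
rewrite raddf_sum -[in RHS]cE -[y@_b]cE mulr_suml; apply: eq_bigr => k _.
rewrite raddf_sum mulr_sumr; apply: eq_bigr => l _.
by rewrite /= mcoeffZ mcoeff_basis xpair_eqE -mulnb natrM mulrACA.
Qed.

(** * The dual basis M* *)

Lemma ltn_count (T : eqType) (a1 a2 : pred T) (s : seq T) x :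
  subpred a1 a2 -> x \in s -> a2 x -> ~~ a1 x -> (count a1 s < count a2 s)%N.
Proof.
move=> a12 + a2x a1x; elim: s => //= y s IH; rewrite inE => /orP[/eqP<-|xs].
  by rewrite a2x (negbTE a1x) ltnS sub_count.
by have := a12 y; have := IH xs; case: (a1 y) => [|_ _]; [move=> ? -> //; lia | lia].
Qed.

Section Mobius.
Variable n : nat.
Implicit Types t s u : bt.

Let below t s := count (fun u => tle t u && tle u s && (u != s)) (trees n).

(** The recursion passes from [s] to some [u < s] above [t]. Then [below t u < below t s], because
    [u] is counted for [s] but not for itself; thus [below t s] is enough fuel. *)
Lemma mob_fuelS k t s : t \in trees n -> (below t s <= k)%N ->
  mob_fuel k.+1 n t s = mob_fuel k n t s.
Proof.
move=> tn; elim: k s => [|k IH] s hk.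
  rewrite /=; case: eqVneq => // ts; case: ifP => // tles.
  suff : (0 < below t s)%N by lia.
  by rewrite /below -has_count; apply/hasP; exists t; rewrite // tle_refl tles ts.
rewrite [LHS]/= [RHS]/=; case: eqP => // _; case: ifP => // _; congr (- _).
rewrite big_seq_cond [RHS]big_seq_cond; apply: eq_bigr => u.
case/and3P=> un /andP[tu us] nus; apply: IH.
suff : (below t u < below t s)%N by lia.
apply: (@ltn_count _ _ _ _ u) => //=; last 2 first.
- by rewrite tu us nus.
- by rewrite eqxx andbF.
move=> v /= /andP[/andP[-> vu] nvu]; rewrite (tle_trans vu us) /=.
by apply: contraNneq nvu => vs; rewrite (tle_anti vu) // vs.
Qed.

Lemma mobiusE t s : t \in trees n -> mobius n t s =
  if t == s then 1 else if tle t s then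
    - \sum_(u <- trees n | tle t u && tle u s && (u != s)) mobius n t u
  else 0.
Proof. by move=> tn; rewrite /mobius -mob_fuelS // count_size. Qed.

Definition mobius_coef t s : rat := if tle t s then mobius n t s else 0.

(** The recursion makes the sum of [mobius n t] over the interval from [t] to [s] vanish when
    [t < s]; for [t = s] the interval is a point. *)
Lemma sum_mobius t s : t \in trees n -> s \in trees n ->
  \sum_(u <- trees n) mobius_coef t u * (tle u s)%:R = (t == s)%:R.
Proof.
move=> tn sn.
transitivity (\sum_(u <- trees n | tle t u && tle u s) mobius n t u).
  rewrite [RHS]big_mkcond; apply: eq_bigr => u _; rewrite /mobius_coef.
  by case: (tle t u); case: (tle u s); rewrite ?mulr1 ?mulr0 ?mul0r.
case: (boolP (tle t s)) => ts; last first.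
  rewrite big_pred0 => [|u]; last by apply: contraNF ts => /andP[]; apply: tle_trans.
  by case: eqVneq => // e; rewrite e tle_refl in ts.
rewrite (bigID (pred1 s)) /= (eq_bigl (pred1 s)) => [|u]; last first.
  by rewrite /= andb_idl // => /eqP->; rewrite ts tle_refl.
rewrite -big_filter filter_pred1_uniq ?trees_uniq // big_seq1.
rewrite mobiusE // ts; case: eqVneq => [e|_]; last by rewrite addNr.
rewrite big1 ?addr0 // => u /andP[/andP[tu us] nus].
by rewrite e in tu; rewrite (tle_anti us tu) eqxx in nus.
Qed.

Let tr := nth Lf (trees n).

Lemma tr_mem (i : 'I_(size (trees n))) : tr i \in trees n.
Proof. exact: mem_nth. Qed.

Lemma sum_tr (V : nmodType) (P : pred bt) (F : bt -> V) :
  \sum_(i < size (trees n) | P (tr i)) F (tr i) = \sum_(u <- trees n | P u) F u.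
Proof. by rewrite (big_nth Lf) big_mkord. Qed.

Definition zeta_mx : 'M[rat]_(size (trees n)) :=
  \matrix_(i, j) (tle (tr i) (tr j))%:R.

Lemma mul_Mmat_zeta : Mmat n *m zeta_mx = 1%:M.
Proof.
apply/matrixP => i j; rewrite !mxE.
under eq_bigr => k _ do rewrite !mxE.
rewrite (sum_tr predT (fun u => mobius_coef (tr i) u * (tle u (tr j))%:R)).
rewrite sum_mobius ?tr_mem //; congr (nat_of_bool _)%:R.
by rewrite nth_uniq // trees_uniq.
Qed.

Lemma invmx_Mmat : invmx (Mmat n) = zeta_mx.
Proof.
have [uM _] := mulmx1_unit mul_Mmat_zeta.
by rewrite -[LHS]mulmx1 -mul_Mmat_zeta mulKmx.
Qed.

(** A one-sided inverse of a square matrix is two-sided, and these are the entries of the product in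
    the other order. *)
Lemma sum_zeta t s : t \in trees n -> s \in trees n ->
  \sum_(u <- trees n) (tle t u)%:R * mobius_coef u s = (t == s)%:R.
Proof.
move=> tn sn.
have it : (index t (trees n) < size (trees n))%N by rewrite index_mem.
have is_ : (index s (trees n) < size (trees n))%N by rewrite index_mem.
have /matrixP/(_ (Ordinal it) (Ordinal is_)) := mulmx1C mul_Mmat_zeta.
rewrite !mxE; under eq_bigr => k _ do rewrite !mxE.
rewrite /tr !nth_index //.
rewrite (sum_tr predT (fun u => (tle t u)%:R * mobius_coef u s)) => ->.
congr (nat_of_bool _)%:R; rewrite -val_eqE /=.
by apply/eqP/eqP => [e|->//]; rewrite -(nth_index Lf tn) e nth_index.
Qed.

End Mobius.

Lemma MstarE t : Mstar t = \sum_(s <- trees (sbt t)) (tle s t)%:R *: << s >>.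
Proof.
rewrite /Mstar invmx_Mmat.
rewrite -[RHS](sum_tr _ predT (fun s => (tle s t)%:R *: << s >>)).
apply: eq_bigr => i _; under eq_bigr => j _ do rewrite mxE.
rewrite (@sum_tr (sbt t) _ (pred1 t) (fun u => (tle _ u)%:R *: << _ >>)).
by rewrite -big_filter filter_pred1_uniq ?trees_uniq ?mem_trees // big_seq1.
Qed.

Lemma mcoeff_Mstar t s : (Mstar t)@_s = (tle s t)%:R.
Proof.
rewrite MstarE raddf_sum /=.
under eq_bigr => u _ do rewrite mcoeffZ mcoeff_basis.
rewrite sum_delta ?trees_uniq // mem_trees; case: eqP => // e.
by case: (boolP (tle s t)) => // /tle_sbt.
Qed.

Lemma lext_Mstar (V : lmodType rat) (g : bt -> V) t :
  lext g (Mstar t) = \sum_(s <- trees (sbt t)) (tle s t)%:R *: g s.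
Proof.
rewrite MstarE linear_sum; apply: eq_bigr => s _.
by rewrite linearZ /= lextU.
Qed.

(** * Bijectivity of [Phi] *)

Fixpoint phi_inv (t : bt) : forest :=
  if t is Nd l r then PNode (phi_inv l) :: phi_inv r else [::].

Lemma phi_invK : cancel phi_inv phi.
Proof. by elim=> // l IHl r IHr; rewrite [phi_inv _]/= phi_cons IHl IHr. Qed.

Lemma phiK : cancel phi phi_inv.
Proof.
by elim/forest_ind => // ts f IHts IHf; rewrite phi_cons /= IHts IHf.
Qed.

(** Moebius inversion expresses [F*_t] as the sum of [mu(s,t) M*_s] over [s <= t]; here each [M*_s]
    is replaced by its forest. *)
Definition Psi : Free bt -> Free (seq ptree) := lext (fun t =>
  \sum_(s <- trees (sbt t)) mobius_coef (sbt t) s t *: << phi_inv s >>).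

Lemma PhiK : cancel Phi Psi.
Proof.
move=> x; rewrite /Phi /Psi lext_comp -[RHS]lext_id; apply: eq_lext => f.
rewrite lext_Mstar -[in RHS](phiK f); set t := phi f.
transitivity (\sum_(u <- trees (sbt t)) \sum_(s <- trees (sbt t))
    ((tle u t)%:R * mobius_coef (sbt t) s u) *: (<< phi_inv s >> : Free (seq ptree))).
  rewrite big_seq [RHS]big_seq; apply: eq_bigr => u; rewrite mem_trees => /eqP->.
  by rewrite scaler_sumr; apply: eq_bigr => s _; rewrite scalerA.
rewrite exchange_big /= (bigD1_seq t) ?trees_uniq ?mem_trees //=.
have key s : s \in trees (sbt t) ->
    \sum_(u <- trees (sbt t))
      ((tle u t)%:R * mobius_coef (sbt t) s u) *: (<< phi_inv s >> : Free (seq ptree)) =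
    (s == t)%:R *: << phi_inv s >>.
  move=> hs; rewrite -scaler_suml -(sum_mobius hs) ?mem_trees //.
  by congr (_ *: _); apply: eq_bigr => u _; rewrite mulrC.
rewrite key ?mem_trees // eqxx scale1r big_seq_cond big1 ?addr0 // => s.
by case/andP=> /key-> /negbTE->; rewrite scale0r.
Qed.

Lemma PsiK : cancel Psi Phi.
Proof.
move=> x; rewrite /Phi /Psi lext_comp -[RHS]lext_id; apply: eq_lext => t.
rewrite linear_sum /=; under eq_bigr => s _ do rewrite linearZ /= lextU phi_invK.
apply/malgP => u; rewrite raddf_sum /= mcoeff_basis.
under eq_bigr => s _ do rewrite mcoeffZ mcoeff_Mstar mulrC.
case: (boolP (u \in trees (sbt t))) => hu; last first.
  rewrite big_seq big1 => [|s]; last first.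
    rewrite mem_trees => /eqP hs; case: (boolP (tle u s)) => [/tle_sbt e|].
      by rewrite mem_trees e hs eqxx in hu.
    by rewrite mul0r.
  by case: eqVneq => // e; rewrite -e mem_trees eqxx in hu.
by rewrite (sum_zeta hu) ?mem_trees // eq_sym.
Qed.

(** * Compatibility with the Hopf structures *)

Lemma mcoeff_Phi x s :
  (Phi x)@_s = \sum_(f <- msupp x) x@_f * (tle s (phi f))%:R.
Proof. by rewrite mcoeff_lext; apply: eq_bigr => f _; rewrite mcoeff_Mstar. Qed.

Lemma Phi_homog n x : homog nck_deg n x -> homog sbt n (Phi x).
Proof.
move=> /allP hx; apply/allP => s; rewrite -mcoeff_neq0; apply: contraR => hs.
rewrite mcoeff_Phi big_seq big1 // => f /hx; rewrite nck_degE => /eqP hf.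
case: (boolP (tle s _)) => [/tle_sbt e|_]; last by rewrite mulr0.
by rewrite e hf eqxx in hs.
Qed.

Lemma Mstar_Lf : Mstar Lf = << Lf >>.
Proof.
by apply/malgP => s; rewrite mcoeff_Mstar mcoeff_basis tle_Lf eq_sym.
Qed.

(** The first part of a splitting at leaf [i] has size [i], so only [i = sbt a] can produce
    [(a, b)]. *)
Lemma mcoeff_ysym_cop t a b : (sbt a <= sbt t)%N ->
  (ysym_cop t)@_(a, b) = (bsplit t (sbt a) == (a, b))%:R.
Proof.
move=> ha; rewrite raddf_sum /= (bigD1 (inord (sbt a))) //= mcoeff_basis inordK //.
rewrite big1 ?addr0 // => i hi; rewrite mcoeff_basis; case: eqP => // e.
have := sbt_bsplit1 (leq_ord i); rewrite e /= => ei.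
by rewrite ei inord_val eqxx in hi.
Qed.

(** The coefficient of [F*_t] counts the splittings of [t] into a pair below [(a, b)]. Degrees leave
    only leaf [sbt a], and [tle_over] turns the condition there into [t <= a \ b]. *)
Lemma lr_mul_Mstar a b : lr_mul (Mstar a) (Mstar b) = Mstar (over a b).
Proof.
rewrite /lr_mul bilextE lext_Mstar; apply/malgP => t.
rewrite mcoeff_Mstar raddf_sum /=.
have [ht|ht] := eqVneq (sbt t) (sbt a + sbt b)%N; last first.
  case: (boolP (tle t _)) => [/tle_sbt|_].
    by rewrite sbt_over => /eqP; rewrite (negbTE ht).
  rewrite big_seq big1 // => s; rewrite mem_trees => /eqP hs.
  rewrite lext_Mstar mcoeffZ raddf_sum big_seq big1 ?mulr0 // => u.
  rewrite mem_trees => /eqP hu; rewrite /= mcoeffZ raddf_sum big_seq big1 ?mulr0 // => v.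
  rewrite mem_trees /= mcoeffZ mcoeff_basis hs hu => /eqP hv.
  by case: eqP => [e|]; rewrite ?mulr0 // -e hv eqxx in ht *.
rewrite tle_over -mulnb natrM; set t0 := (bsplit t _).1; set t1 := (bsplit t _).2.
have h0 : t0 \in trees (sbt a) by rewrite mem_trees sbt_bsplit1 // ht leq_addr.
have h1 : t1 \in trees (sbt b) by rewrite mem_trees sbt_bsplit2 ht ?leq_addr // addKn.
transitivity (\sum_(s <- trees (sbt a))
    ((tle s a)%:R * (tle t1 b)%:R) * (s == t0)%:R : rat);
  last by rewrite sum_delta ?trees_uniq ?h0.
rewrite big_seq [RHS]big_seq; apply: eq_bigr => s; rewrite mem_trees => /eqP hs.
rewrite mcoeffZ -mulrA; congr (_ * _); rewrite lext_Mstar raddf_sum /=.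
transitivity (\sum_(u <- trees (sbt b))
    ((tle u b)%:R * (s == t0)%:R) * (u == t1)%:R : rat);
  last by rewrite sum_delta ?trees_uniq ?h1.
rewrite big_seq [RHS]big_seq; apply: eq_bigr => u; rewrite mem_trees => /eqP hu.
rewrite mcoeffZ -mulrA; congr (_ * _); rewrite raddf_sum /=.
under eq_bigr => v _ do rewrite mcoeffZ mcoeff_basis.
rewrite sum_delta ?trees_uniq // mem_trees hs hu ht eqxx.
rewrite mcoeff_ysym_cop hs ?ht ?leq_addr // -natrM mulnb.
by rewrite [bsplit t _]surjective_pairing xpair_eqE eq_sym [_ == u]eq_sym.
Qed.

Lemma ysym_mulE a b : ysym_mul a b = \sum_(x <- prods a b) << x >>.
Proof. exact: (sum_graft_divide a b (fun x => << x >>)). Qed.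

(** The restriction to complementary degrees in [lr_cop_basis] loses nothing, since all terms of
    [F_a F_b] have size [sbt a + sbt b]. *)
Lemma mcoeff_lr_cop_basis t a b :
  (lr_cop_basis t)@_(a, b) = (ysym_mul a b)@_t.
Proof.
transitivity (\sum_(p < (sbt t).+1)
    if (sbt a == p) && (sbt b == sbt t - p)%N then (ysym_mul a b)@_t else 0).
  rewrite raddf_sum /=; apply: eq_bigr => p _; rewrite raddf_sum /=.
  transitivity (\sum_(a' <- trees p)
      (if (sbt b == sbt t - p)%N then (ysym_mul a' b)@_t else 0) * (a' == a)%:R).
    apply: eq_bigr => a' _; rewrite raddf_sum /=.
    transitivity (\sum_(b' <- trees (sbt t - p))
      ((ysym_mul a' b')@_t * (a' == a)%:R) * (b' == b)%:R).
      apply: eq_bigr => b' _; rewrite mcoeffZ mcoeff_basis xpair_eqE -mulnb natrM.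
      by rewrite mulrA.
    rewrite sum_delta ?trees_uniq // mem_trees; case: ifP => //.
    by rewrite mul0r.
  by rewrite sum_delta ?trees_uniq // mem_trees; case: ifP.
have [hab|hab] := eqVneq (sbt a + sbt b)%N (sbt t).
  rewrite (bigD1 (inord (sbt a))) //= inordK; last by lia.
  have -> : (sbt b == sbt t - sbt a)%N by lia.
  rewrite eqxx big1 ?addr0 // => p hp.
  case: ifP => // /andP[/eqP e _].
  by rewrite e inord_val eqxx in hp.
rewrite big1 => [|p _]; last first.
  rewrite ifF //; apply: contraNF hab => /andP[/eqP-> /eqP->].
  by have := leq_ord p; lia.
rewrite ysym_mulE raddf_sum /= big_seq big1 // => x /sbt_prods hx.
by rewrite mcoeff_basis; case: eqP => // e; rewrite -e hx eqxx in hab.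
Qed.

(** Comparing coefficients at [(a, b)] reduces this to the count in [count_prods_cuts]. *)
Lemma lr_cop_Mstar f : lr_cop (Mstar (phi f)) =
  \sum_(c <- cuts f) tensv (Mstar (phi c.1)) (Mstar (phi c.2)).
Proof.
apply/malgP => -[a b]; rewrite /lr_cop lext_Mstar !raddf_sum /=.
under [RHS]eq_bigr => c _ do rewrite mcoeff_tensv !mcoeff_Mstar -natrM mulnb.
rewrite -count_prods_cuts; set t := phi f.
under eq_bigr => s _ do
  rewrite mcoeffZ mcoeff_lr_cop_basis ysym_mulE raddf_sum mulr_sumr.
rewrite exchange_big /=; apply: eq_bigr => x _.
under eq_bigr => s _ do rewrite mcoeff_basis eq_sym.
rewrite sum_delta ?trees_uniq // mem_trees; case: eqP => // e.
by case: (boolP (tle x t)) => // /tle_sbt.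
Qed.

(* Phi : NCK -> LR, Phi(f) = M*_{phi(f)}, is an isomorphism of graded Hopf
   algebras: a bijective, degree-preserving linear map compatible with unit,
   product, counit and coproduct. *)
Theorem theorem8p10 :
  bijective Phi /\
  (forall (n : nat) (x : Free (seq ptree)), homog nck_deg n x -> homog sbt n (Phi x)) /\
  Phi nck_one = lr_one /\
  (forall x y : Free (seq ptree), Phi (nck_mul x y) = lr_mul (Phi x) (Phi y)) /\
  (forall x : Free (seq ptree), lr_counit (Phi x) = nck_counit x) /\
  (forall x : Free (seq ptree), lr_cop (Phi x) = tensmap Phi (nck_cop x)).
Proof.
split; first exact: Bijective PhiK PsiK.
split; first exact: Phi_homog.
split; first by rewrite /Phi lextU Mstar_Lf.
split=> [x y|].
  rewrite /nck_mul /lr_mul /Phi bilext_lext !bilextE lext_comp.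
  apply: eq_lext => f; rewrite lext_comp; apply: eq_lext => g.
  by rewrite lextU phi_cat -lr_mul_Mstar.
split=> x.
  rewrite /lr_counit mcoeff_Phi /nck_counit.
  (* Only the empty forest contributes to the coefficient of [F*_|], because comparable trees have
     equal size. *)
  have e f : tle Lf (phi f) = (f == [::]).
    by rewrite tle_Lfl; case: f => // -[].
  under eq_bigr => f _ do rewrite e.
  rewrite sum_delta ?fset_uniq //; case: ifP => // /negbT/mcoeff_outdom.
  by move=> ->.
rewrite /lr_cop /Phi lext_comp /tensmap /nck_cop lext_comp.
apply: eq_lext => f; rewrite -/(lr_cop _) lr_cop_Mstar nck_cop_basisE linear_sum.
by apply: eq_bigr => c _; rewrite /= lextU /= !lextU.
Qed.
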